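(* Let $n,k\ge 1$ be integers, let $P\in\mathbb C[z]$ be a polynomial of degree $n$, and let $\xi\in\mathbb C$. Then there is a unique polynomial $Q\in\mathbb C[z]$ of degree $n$, with the same leading coefficient as $P$, such that $$\frac{\mathrm d^k}{\mathrm dz^k}\bigl((z-\xi)^kQ(z)\bigr)=(n+1)_k\,P(z).$$ Moreover, let $$S_{n,k}(w)=\sum_{j=0}^n\binom{n+k}{j+k}w^j .$$ If $K\subset\mathbb C$ is an open or closed disc, an open or closed half-plane, or the open or closed exterior of a disc, and $K$ contains every zero of the polynomial $w\mapsto P(\xi+w)$, then every zero $q$ of $Q$ can be written $$q=\xi-\alpha\beta,\quad \alpha\in K,\quad \beta\in Z(S_{n,k}).$$
   Context: $(a)_k:=a(a+1)\cdots(a+k-1)$ denotes the rising factorial. $Z(F)$ denotes the set of complex zeros of a polynomial $F$. All polynomials have complex coefficients. *)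

(* Defs.v *)
From HB Require Import structures.
From mathcomp Require Import all_boot all_order all_algebra.
From mathcomp Require Import complex.
From mathcomp Require Import classical_sets reals.

Set Implicit Arguments.
Unset Strict Implicit.
Unset Printing Implicit Defensive.

Import Order.TTheory GRing.Theory Num.Theory.

Local Open Scope classical_set_scope.
Local Open Scope ring_scope.
Local Open Scope complex_scope.

(* For [R : realType], the field [R[i]] is the field of complex numbers; the
   order on it is the partial one, and the norm [`|z|] is the modulus, seen as
   an element of [R[i]], hence the casts [r%:C] of real radii below. *)

Definition rising_factorial (A : pzRingType) (a : A) (k : nat) : A :=
  \prod_(i < k) (a + i%:R).

Definition zeros (R : realType) (F : {poly R[i]}) : set R[i] :=
  [set z | root F z].

(* A half-plane is given by a nonzero [a] (the conjugate of an inward normal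
   vector) and a real threshold [t]. *)
Inductive circular_region (R : realType) : set R[i] -> Prop :=
| OpenDisc (c : R[i]) (r : R) of 0 < r :
    circular_region [set z | `|z - c| < r%:C]
| ClosedDisc (c : R[i]) (r : R) of 0 < r :
    circular_region [set z | `|z - c| <= r%:C]
| OpenHalfPlane (a : R[i]) (t : R) of a != 0 :
    circular_region [set z | t < complex.Re (a * z)]
| ClosedHalfPlane (a : R[i]) (t : R) of a != 0 :
    circular_region [set z | t <= complex.Re (a * z)]
| OpenExterior (c : R[i]) (r : R) of 0 < r :
    circular_region [set z | r%:C < `|z - c|]
| ClosedExterior (c : R[i]) (r : R) of 0 < r :
    circular_region [set z | r%:C <= `|z - c|].

Definition S_poly (R : realType) (n k : nat) : {poly R[i]} :=
  \sum_(j < n.+1) 'C(n + k, j + k)%:R *: 'X^j.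

(* [size F = n.+1] says that [F] is nonzero of degree exactly [n]. *)
Definition is_Q (R : realType) (n k : nat) (P : {poly R[i]}) (xi : R[i])
    (Q : {poly R[i]}) : Prop :=
  [/\ size Q = n.+1,
      lead_coef Q = lead_coef P &
      (('X - xi%:P) ^+ k * Q)^`(k) = rising_factorial n.+1%:R k *: P].

(* Main.v *)
(* In powers of z - xi the coefficients of Q are those of P multiplied by
   'C(n + k, j + k) / 'C(n, j), so Q is the Szego composition of P with
   S_{n,k}: for g = q - xi, a zero q of Q amounts to the apolarity of
   P(xi + w) and w^n S(-g / w).  By Grace's theorem some zero m of the latter
   lies in K, and then alpha = m, beta = -g / m.

   Grace's theorem follows by iterating Laguerre's theorem: for m outside K, the
   polar derivative of P at m again has its zeros in K.  The degree drops by
   exactly one when K is convex; otherwise the complement of K is convex and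
   the two polynomials exchange roles. *)

Require Import Defs.
From HB Require Import structures.
From mathcomp Require Import all_boot all_order all_algebra.
From mathcomp Require Import complex.
From mathcomp Require Import boolp classical_sets reals.
From mathcomp Require Import ring lra.

Set Implicit Arguments.
Unset Strict Implicit.
Unset Printing Implicit Defensive.

Import Order.TTheory GRing.Theory Num.Theory.

Local Open Scope classical_set_scope.
Local Open Scope ring_scope.
Local Open Scope complex_scope.

(** * Apolarity and polar derivatives *)

(* [P] and [G] are coefficient sequences: they play the role of polynomials of
   formal degree [n]. *)
Definition apolar (A : pzRingType) (n : nat) (P G : nat -> A) : A :=
  \sum_(j < n.+1) (-1) ^+ j * (j`! * (n - j)`!)%:R * (P j * G (n - j)%N).

Lemma apolarC (A : comPzRingType) n (P G : nat -> A) :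
  apolar n P G = (-1) ^+ n * apolar n G P.
Proof.
rewrite /apolar big_distrr (reindex_inj rev_ord_inj) /=.
apply: eq_bigr => j _; have jn : (j <= n)%N by rewrite -ltnS.
have -> : (-1) ^+ n = (-1) ^+ (n - j) * (-1) ^+ j :> A by rewrite -exprD subnK.
rewrite subSS subKn // (mulnC (n - j)`!) (mulrC (P _)) -!mulrA.
by rewrite (mulrA ((-1) ^+ j) ((-1) ^+ j)) -expr2 sqrr_sign mul1r.
Qed.

(** Laguerre's polar derivative with pole [m], for the formal degree [n]: the terms in ['X^n] coming
    from a [P] of degree [n] cancel. *)
Definition polar (A : nzRingType) (n : nat) (m : A) (P : {poly A}) : {poly A} :=
  n%:R *: P - ('X - m%:P) * P^`().

Lemma coef_polar (A : nzRingType) n (m : A) (P : {poly A}) j : (j <= n)%N ->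
  (polar n m P)`_j = P`_j *+ (n - j) + m * P`_j.+1 *+ j.+1.
Proof.
move=> jn; rewrite coefB coefZ mulrBl coefB coefCM coefXM !coef_deriv mulr_natl.
rewrite opprB addrA addrAC mulrnAr; congr (_ + _).
by case: j jn => [|j] jn /=; rewrite ?subn0 ?subr0 // mulrnBr // ltnW.
Qed.

(** Adjointness: a linear factor of one argument is traded for a polar derivative of the other. *)
Lemma apolar_polar (A : comNzRingType) n (m : A) (P G : {poly A}) :
  (size G <= n.+1)%N ->
  apolar n.+1 (nth 0 P) (nth 0 (('X - m%:P) * G)) =
  apolar n (nth 0 (polar n.+1 m P)) (nth 0 G).
Proof.
move=> sG; rewrite /apolar.
pose a j : A := (-1) ^+ j * (j`! * (n.+1 - j)`!)%:R * P`_j.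
transitivity (\sum_(j < n.+2) a j * ('X * G)`_(n.+1 - j)
   - \sum_(j < n.+2) a j * (m * G`_(n.+1 - j))).
  rewrite -sumrB; apply: eq_bigr => j _.
  by rewrite mulrBl coefB coefCM /a -mulrBr !mulrA.
(* The first sum loses its last term, since ['X * G] has no constant term, and the second its term
   [j = 0], where [G] is read beyond its degree. Once shifted, the second pairs with the first as
   the two terms of [coef_polar]. *)
rewrite big_ord_recr /= subnn coefXM eqxx mulr0 addr0.
rewrite [X in _ - X]big_ord_recl /= subn0 (nth_default 0 sG) !mulr0 add0r.
rewrite -sumrB; apply: eq_bigr => j _; have jn : (j <= n)%N by rewrite -ltnS.
rewrite /bump /= add1n subSS coefXM subSn //= coef_polar ?leqW // subSn //.
rewrite /a subSn // subSS !factS exprS.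
rewrite !natrM -(mulr_natr P`_j) -(mulr_natr (m * _)).
move: j.+1%:R (n - j).+1%:R j`!%:R (n - j)`!%:R ((-1) ^+ j) => b c d e f.
move: P`_j P`_j.+1 G`_(n - j) => x y z; ring.
Qed.

(** * The theorems of Laguerre and Grace *)

Section Complex.
Variable R : realType.
Local Notation C := R[i].
Implicit Types (P G : {poly C}) (K : set C) (s : seq C).

Lemma horner_deriv_prod s z : z \notin s ->
  (\prod_(l <- s) ('X - l%:P))^`().[z] =
  (\prod_(l <- s) ('X - l%:P)).[z] * \sum_(l <- s) (z - l)^-1.
Proof.
elim: s => [|l s IH]; first by rewrite !big_nil mulr0 derivC horner0.
rewrite inE negb_or => /andP[zl zs].
rewrite !big_cons derivM derivXsubC mul1r hornerD !hornerM hornerXsubC IH //.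
by rewrite mulrDr mulrAC divff ?subr_eq0 // mul1r mulrA.
Qed.

(* Stability under means, and under means taken in the coordinate 1 / (z - l)
   for every z outside K: what Laguerre's theorem needs, respectively, for the
   degree and for the zeros of a polar derivative. *)
Definition laguerre_convex K : Prop :=
  forall s, s != [::] -> {in s, forall l, K l} ->
  (forall m, m *+ size s = \sum_(l <- s) l -> K m) /\
  (forall z m, ~ K z -> z != m ->
     (z - m)^-1 *+ size s = \sum_(l <- s) (z - l)^-1 -> K m).

(** With [l] running through the zeros of [P], a drop of more than one in the degree would make [m]
    the mean of the [l], and a zero [z] outside [K] would make 1 / (z - m) the mean of the 1 / (z -
    l). Either way [m] would lie in [K]. *)
Lemma laguerre K n P m : laguerre_convex K -> size P = n.+2 ->
  zeros P `<=` K -> ~ K m ->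
  size (polar n.+1 m P) = n.+1 /\ zeros (polar n.+1 m P) `<=` K.
Proof.
move=> cK sP PK Km; have [s Ps] := closed_field_poly_normal P.
have c0 : lead_coef P != 0 by rewrite lead_coef_eq0 -size_poly_eq0 sP.
have ss : size s = n.+1.
  by have := sP; rewrite {1}Ps size_scale // size_prod_XsubC => -[].
have s0 : s != [::] by case: (s) ss.
have sK : {in s, forall l, K l}.
  by move=> l ls; apply: PK; rewrite /zeros /= Ps rootZ // root_prod_XsubC.
have [K1 K2] := cK _ s0 sK.
split.
  apply/eqP; rewrite eqn_leq; apply/andP; split.
    apply/leq_sizeP => j; rewrite leq_eqVlt => /orP[/eqP <-|nj].
      by rewrite coef_polar // subnn mulr0n add0r nth_default ?sP // mulr0 mul0rn.
    have s2 : (size (polar n.+1 m P) <= n.+2)%N.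
      rewrite (leq_trans (size_polyD _ _)) // geq_max size_polyN.
      rewrite (leq_trans (size_scale_leq _ _)) ?sP //=.
      rewrite (leq_trans (size_polyMleq _ _)) // size_XsubC /=.
      by rewrite -sP lt_size_deriv // -size_poly_eq0 sP.
    by rewrite nth_default // (leq_trans s2).
  rewrite ltnNge; apply/negP => /leq_sizeP/(_ n (leqnn _)).
  rewrite coef_polar // subSn // subnn mulr1n.
  have -> : P`_n.+1 = lead_coef P by rewrite lead_coefE sP.
  have -> : P`_n = - lead_coef P * \sum_(l <- s) l.
    by rewrite [in LHS]Ps coefZ mulNr -mulrN -coefPn_prod_XsubC ss.
  rewrite (mulrC m) -mulrnAr mulNr addrC -mulrBr => /eqP.
  rewrite mulf_eq0 (negPf c0) /= subr_eq0 => /eqP e.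
  by apply: Km; apply: K1; rewrite ss.
move=> z /rootP; rewrite /polar !hornerE => e; apply: contrapT => Kz.
have zs : z \notin s by apply/negP => /sK.
have Pz : P.[z] != 0 by apply/negP => /PK.
have dP : P^`().[z] = P.[z] * \sum_(l <- s) (z - l)^-1.
  by rewrite Ps derivZ !hornerZ horner_deriv_prod // mulrA.
move: e; rewrite dP mulrCA mulrC -mulrBr => /eqP.
rewrite mulf_eq0 (negPf Pz) subr_eq0 /= => /eqP e.
have zm : z != m.
  by apply: contra_eqN e => /eqP ->; rewrite subrr mul0r pnatr_eq0.
apply: Km; apply: (K2 _ _ Kz zm); rewrite ss -mulr_natr e mulKf //.
by rewrite subr_eq0.
Qed.

(** Induction on [s]: [apolar_polar] moves each factor over to [P], and [laguerre] restores the
    hypotheses, until [P] is a nonzero constant. *)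
Lemma grace K P s : laguerre_convex K -> size P = (size s).+1 ->
  zeros P `<=` K -> {in s, forall m, ~ K m} ->
  apolar (size s) (nth 0 P) (nth 0 (\prod_(m <- s) ('X - m%:P))) != 0.
Proof.
move=> cK; elim: s P => [|m s IH] P sP PK sK.
  rewrite /apolar big_ord1 big_nil coefC /= !mulr1 !mul1r.
  by have := lead_coef_eq0 P; rewrite lead_coefE sP => ->; rewrite -size_poly_eq0 sP.
have [sD DK] := laguerre cK sP PK (sK m (mem_head _ _)).
rewrite big_cons /= apolar_polar ?size_prod_XsubC //.
by apply: IH => // x xs; apply: sK; rewrite inE xs orbT.
Qed.

Lemma grace_zeros K P G n : laguerre_convex K -> size P = n.+1 -> size G = n.+1 ->
  zeros P `<=` K -> apolar n (nth 0 P) (nth 0 G) = 0 ->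
  exists2 m, root G m & K m.
Proof.
move=> cK sP sG PK PG; apply: contrapT => H.
have [s Gs] := closed_field_poly_normal G.
have c0 : lead_coef G != 0 by rewrite lead_coef_eq0 -size_poly_eq0 sG.
have ss : size s = n.
  by have := sG; rewrite {1}Gs size_scale // size_prod_XsubC => -[].
have /negP[] : apolar (size s) (nth 0 P) (nth 0 (\prod_(m <- s) ('X - m%:P))) != 0.
  apply: (grace cK) => //; rewrite ?ss // => m ms Km; apply: H; exists m => //.
  by rewrite Gs rootZ // root_prod_XsubC.
apply/eqP/(mulfI c0); rewrite mulr0 -[RHS]PG ss /apolar big_distrr /=.
apply: eq_bigr => j _; rewrite [in RHS]Gs coefZ.
rewrite (mulrCA P`_j).
by rewrite (mulrCA _ (lead_coef G)).
Qed.

(** In the second case, if [G] had no zero in [K], then [grace_zeros] for the complement would give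
    a zero of [P] outside [K]. *)
Lemma grace_zerosC K P G n :
  laguerre_convex K \/ laguerre_convex (~` K) -> size P = n.+1 -> size G = n.+1 ->
  zeros P `<=` K -> apolar n (nth 0 P) (nth 0 G) = 0 ->
  exists2 m, root G m & K m.
Proof.
move=> [cK|cK] sP sG PK PG; first exact: grace_zeros PK PG.
apply: contrapT => H.
have GK : zeros G `<=` ~` K by move=> z Gz Kz; apply: H; exists z.
have GP : apolar n (nth 0 G) (nth 0 P) = 0 by rewrite apolarC PG mulr0.
have [m Pm] := grace_zeros cK sG sP GK GP.
by apply; apply: PK.
Qed.


(** * Circular regions as sublevel sets of quadratic functions *)

Local Notation re := (@complex.Re R).
Local Notation im := (@complex.Im R).

(** One family for discs ([a > 0]) and half-planes ([a = 0]), preserved by inversions up to a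
    positive factor. *)
Definition quad (a b c d : R) (z : C) : R :=
  a * (re z ^+ 2 + im z ^+ 2) + b * re z + c * im z + d.

(* Jensen's inequality, with [m] the mean of [s]. *)
Lemma quad_mean a b c d s m : 0 <= a -> s != [::] ->
  m *+ size s = \sum_(l <- s) l ->
  exists2 l, l \in s & quad a b c d m <= quad a b c d l.
Proof.
move=> a0 s0 ms; apply: contrapT => H.
(* [f] is the linear part of the Taylor expansion [quadE] at [m]. It sums to 0 over [s] because [m]
   is the mean, whereas a counterexample would make every [f l] negative. *)
pose f (l : C) := (2 * a * re m + b) * (re l - re m)
  + (2 * a * im m + c) * (im l - im m).
have quadE l : quad a b c d l = quad a b c d m + f l
   + a * ((re l - re m) ^+ 2 + (im l - im m) ^+ 2).
  by rewrite /quad /f; ring.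
have f_lt0 l : l \in s -> f l < 0.
  move=> ls; rewrite ltNge; apply/negP => fl; apply: H; exists l => //.
  by rewrite (quadE l) -addrA lerDl addr_ge0 // mulr_ge0 // addr_ge0 // sqr_ge0.
have : \sum_(l <- s) f l = 0.
  rewrite big_split /= -!mulr_sumr !sumrB !big_const_seq !count_predT !iter_addr_0.
  have sum_morph (g : C -> R) : {morph g : x y / x + y} -> g 0 = 0 ->
      \sum_(l <- s) g l = g m *+ size s.
    move=> gD g0; rewrite -(big_morph g gD g0) -ms.
    by elim: (size s) => [|k IH]; rewrite ?mulr0n ?mulrS ?gD ?IH.
  rewrite !sum_morph //; do ?by case=> ? ? [? ?].
  by rewrite !subrr !mulr0 addr0.
case: s s0 {ms H} f_lt0 => // l s _ f_lt0; rewrite big_cons => /eqP.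
rewrite lt_eqF // -[ltRHS]addr0 ltr_leD ?f_lt0 ?mem_head //.
rewrite big_seq sumr_le0 // => x xs.
by rewrite ltW // f_lt0 // inE xs orbT.
Qed.

(** Taylor expansion at [z] in h = z - l, rewritten in w = 1 / h: re h = re w / |w|^2 and im h = -
    im w / |w|^2, so the constant and quadratic coefficients swap. *)
Lemma quad_inversion a b c d z l : z != l ->
  quad a b c d l =
  quad (quad a b c d z) (- (2 * a * re z + b)) (2 * a * im z + c) a (z - l)^-1
  * (re (z - l) ^+ 2 + im (z - l) ^+ 2).
Proof.
case: z l => x y [u v]; rewrite eq_complex /= negb_and => zl.
have h : (x - u) ^+ 2 + (y - v) ^+ 2 != 0.
  by rewrite paddr_eq0 ?sqr_ge0 // !sqrf_eq0 !subr_eq0 negb_and.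
by rewrite /quad /=; field.
Qed.

(* By [quad_inversion], the inversion centred at z outside K turns K into
   another quadratic region, whose leading coefficient [quad a b c d z] is
   nonnegative: it is again convex. *)
Lemma quad_laguerre_convex a b c d K : 0 <= a ->
  (forall z, ~ K z -> 0 <= quad a b c d z) ->
  (forall l m r, 0 < r -> K l -> quad a b c d m <= r * quad a b c d l -> K m) ->
  laguerre_convex K.
Proof.
move=> a0 K0 Kle s s0 sK; split=> [m ms|z m Kz zm ms].
  have [l ls ml] := quad_mean b c d a0 s0 ms.
  by apply: (Kle l m 1); rewrite ?mul1r //; apply: sK.
have szK l : l \in s -> z != l by move=> /sK Kl; apply: contra_notN Kz => /eqP ->.
have r0 l : z != l -> 0 < re (z - l) ^+ 2 + im (z - l) ^+ 2.
  move=> zl; rewrite lt0r paddr_eq0 ?sqr_ge0 // !sqrf_eq0 addr_ge0 ?sqr_ge0 // andbT.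
  by move: zl; rewrite -subr_eq0 eq_complex.
have szV : [seq (z - l)^-1 | l <- s] != [::] by case: (s) s0.
have msV : (z - m)^-1 *+ size [seq (z - l)^-1 | l <- s] =
    \sum_(y <- [seq (z - l)^-1 | l <- s]) y by rewrite size_map big_map.
have [_ /mapP[l ls ->] le] := quad_mean (- (2 * a * re z + b))
  (2 * a * im z + c) a (K0 _ Kz) szV msV.
have zl := szK _ ls.
(* The ratio |z - m|^2 / |z - l|^2 of the two factors produced by [quad_inversion]. *)
apply: (Kle l m ((re (z - m) ^+ 2 + im (z - m) ^+ 2)
   / (re (z - l) ^+ 2 + im (z - l) ^+ 2))).
- by rewrite divr_gt0 // r0.
- exact: sK.
rewrite (quad_inversion _ _ _ _ zm) (quad_inversion _ _ _ _ zl).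
by rewrite mulrCA divfK ?gt_eqF ?r0 // ler_pM2r ?r0.
Qed.

Lemma quad_lt0_laguerre_convex a b c d K : 0 <= a ->
  (forall z, K z <-> quad a b c d z < 0) -> laguerre_convex K.
Proof.
move=> a0 KE; apply: (quad_laguerre_convex (b := b) (c := c) (d := d) a0).
  by move=> z Kz; rewrite leNgt; apply/negP => /KE.
move=> l m r r0 /KE ql qm; apply/KE; apply: (le_lt_trans qm).
by rewrite pmulr_rlt0.
Qed.

Lemma quad_le0_laguerre_convex a b c d K : 0 <= a ->
  (forall z, K z <-> quad a b c d z <= 0) -> laguerre_convex K.
Proof.
move=> a0 KE; apply: (quad_laguerre_convex (b := b) (c := c) (d := d) a0).
  by move=> z Kz; rewrite ltW // ltNge; apply/negP => /KE.
move=> l m r r0 /KE ql qm; apply/KE; apply: (le_trans qm).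
by rewrite pmulr_rle0.
Qed.

Definition disc_quad (c : C) (r : R) : C -> R :=
  quad 1 (- (2 * re c)) (- (2 * im c)) (re c ^+ 2 + im c ^+ 2 - r ^+ 2).

Lemma disc_quadE c r z :
  disc_quad c r z = (re z - re c) ^+ 2 + (im z - im c) ^+ 2 - r ^+ 2.
Proof. by rewrite /disc_quad /quad; ring. Qed.

Lemma norm_disc c r z : 0 < r ->
  ((`|z - c| < r%:C) = (disc_quad c r z < 0)) *
  ((`|z - c| <= r%:C) = (disc_quad c r z <= 0)) *
  ((r%:C < `|z - c|) = (0 < disc_quad c r z)) *
  ((r%:C <= `|z - c|) = (0 <= disc_quad c r z)).
Proof.
case: z c => x y [u v] r0; rewrite disc_quadE normc_def !ltcR !lecR /=.
rewrite !(subr_lt0, subr_le0, subr_gt0, subr_ge0).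
have -> : r = Num.sqrt (r ^+ 2) by rewrite sqrtr_sqr gtr0_norm.
rewrite !(leNgt (Num.sqrt (r ^+ 2))) !(ltNge (Num.sqrt (r ^+ 2))).
by rewrite ltr_sqrt ?ler_sqrt ?exprn_gt0 ?sqr_ge0 // sqr_sqrtr ?sqr_ge0 // -leNgt -ltNge.
Qed.

(** Discs and half-planes are treated directly, exteriors through their complements: a closed disc
    for an open exterior, an open disc for a closed one. *)
Lemma circular_region_laguerre_convex K : circular_region K ->
  laguerre_convex K \/ laguerre_convex (~` K).
Proof.
have lt_disc c r K' : (forall z, K' z <-> disc_quad c r z < 0) -> laguerre_convex K'.
  exact: quad_lt0_laguerre_convex.
have le_disc c r K' : (forall z, K' z <-> disc_quad c r z <= 0) -> laguerre_convex K'.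
  exact: quad_le0_laguerre_convex.
case=> [c r r0|c r r0|a t _|a t _|c r r0|c r r0].
- by left; apply: (lt_disc c r) => z /=; rewrite norm_disc.
- by left; apply: (le_disc c r) => z /=; rewrite norm_disc.
- left; apply: (@quad_lt0_laguerre_convex 0 (- re a) (im a) t) => // z /=.
  by rewrite /quad; case: a z => x y [u v] /=; split; lra.
- left; apply: (@quad_le0_laguerre_convex 0 (- re a) (im a) t) => // z /=.
  by rewrite /quad; case: a z => x y [u v] /=; split; lra.
- right; apply: (le_disc c r) => z /=.
  by rewrite norm_disc // leNgt; split=> /negP.
- right; apply: (lt_disc c r) => z /=.
  by rewrite norm_disc // ltNge; split=> /negP.
Qed.
End Complex.

(** * Rising factorials and translations of polynomials *)

Lemma rising_factorial_ffact (A : comNzRingType) n k :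
  rising_factorial (n.+1%:R : A) k = ((n + k) ^_ k)%:R.
Proof.
elim: k => [|k IH]; first by rewrite /rising_factorial big_ord0.
rewrite addnS ffactSS natrM -IH /rising_factorial big_ord_recr /= mulrC.
by rewrite -natrD addSn.
Qed.

Lemma derivn_comp_XaddC (A : comNzRingType) (P : {poly A}) c k :
  (P \Po ('X + c%:P))^`(k) = P^`(k) \Po ('X + c%:P).
Proof.
elim: k => [|k IH]; first by rewrite !derivn0.
by rewrite !derivnS IH deriv_comp derivD derivX derivC addr0 mulr1.
Qed.

Lemma comp_polyXaddC_inj (A : comNzRingType) (c : A) :
  injective (fun P : {poly A} => P \Po ('X + c%:P)).
Proof. by apply: can_inj => P; apply: comp_polyXaddC_K. Qed.

Lemma size_comp_XaddC (A : idomainType) (P : {poly A}) (c : A) :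
  size (P \Po ('X + c%:P)) = size P.
Proof. by rewrite size_comp_poly2 // size_XaddC. Qed.

Lemma lead_coef_comp_XaddC (A : idomainType) (P : {poly A}) (c : A) :
  lead_coef (P \Po ('X + c%:P)) = lead_coef P.
Proof. by rewrite lead_coef_comp ?size_XaddC // lead_coefXaddC expr1n mulr1. Qed.

(** * [Q] as a Szego composition *)

Section Szego.
Variables (R : realType) (n k : nat) (P : {poly R[i]}) (xi : R[i]).
Hypothesis degP : size P = n.+1.
Local Notation p := (P \Po ('X + xi%:P)).

Let ffact_neq0 i : ((k + i) ^_ k)%:R != 0 :> R[i].
Proof. by rewrite pnatr_eq0 -lt0n ffact_gt0 leq_addr. Qed.

(** In powers of z - xi the differential equation is diagonal. At [i = n] the two factors agree,
    which gives the leading coefficient; beyond [n] both sides vanish, which gives the degree. *)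
Lemma is_Q_coef Q : is_Q n k P xi Q <->
  forall i, (Q \Po ('X + xi%:P))`_i * ((k + i) ^_ k)%:R
            = ((n + k) ^_ k)%:R * p`_i.
Proof.
set q := Q \Po _.
have E : (('X - xi%:P) ^+ k * Q)^`(k) = rising_factorial n.+1%:R k *: P <->
    forall i, q`_i * ((k + i) ^_ k)%:R = ((n + k) ^_ k)%:R * p`_i.
  have qE i : ((('X - xi%:P) ^+ k * Q)^`(k) \Po ('X + xi%:P))`_i =
      q`_i * ((k + i) ^_ k)%:R.
    rewrite -derivn_comp_XaddC comp_polyM rmorphXn /= comp_polyB comp_polyX.
    rewrite comp_polyC addrK coef_derivn coefXnM ltnNge leq_addr /= addKn.
    by rewrite mulr_natr.
  rewrite rising_factorial_ffact; split=> [e i|H].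
    by rewrite -qE e comp_polyZ coefZ.
  apply: (@comp_polyXaddC_inj _ xi); apply/polyP => i /=.
  by rewrite qE comp_polyZ coefZ.
split=> [[_ _ /E] //|H]; have nk0 : ((n + k) ^_ k)%:R != 0 :> R[i].
  by rewrite addnC ffact_neq0.
have qn : q`_n = p`_n.
  have := H n; rewrite [in LHS]addnC mulrC => e; exact: (mulfI nk0).
have degp : size p = n.+1 by rewrite size_comp_XaddC.
have pn : p`_n = lead_coef p by rewrite lead_coefE degp.
have degq : size q = n.+1.
  apply/eqP; rewrite eqn_leq; apply/andP; split.
    apply/leq_sizeP => j nj; apply/eqP; have /eqP := H j.
    by rewrite [p`_j]nth_default ?degp // mulr0 mulf_eq0 (negPf (ffact_neq0 _)) orbF.
  rewrite ltnNge; apply/negP => /leq_sizeP/(_ n (leqnn _))/eqP.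
  by rewrite qn pn lead_coef_eq0 -size_poly_eq0 degp.
split; [by rewrite -(size_comp_XaddC _ xi)| |exact/E].
by rewrite -(lead_coef_comp_XaddC Q xi) -(lead_coef_comp_XaddC P xi) -pn -qn lead_coefE degq.
Qed.

Lemma is_Q_exists_unique : exists! Q, is_Q n k P xi Q.
Proof.
pose b i : R[i] := ((n + k) ^_ k)%:R * p`_i / ((k + i) ^_ k)%:R.
exists ((\poly_(i < n.+1) b i) \Po ('X - xi%:P)); split.
  apply/is_Q_coef => i.
  have := comp_polyXaddC_K (\poly_(j < n.+1) b j) (- xi).
  rewrite polyCN opprK => ->; rewrite coef_poly.
  case: ltnP => ni; first by rewrite /b divfK.
  by rewrite mul0r nth_default ?mulr0 // size_comp_XaddC degP.
move=> Q /is_Q_coef HQ; rewrite -[RHS](comp_polyXaddC_K Q xi); congr (_ \Po _).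
apply/polyP => i; rewrite coef_poly; case: ltnP => ni.
  by rewrite /b -HQ mulfK.
apply/esym/eqP; have /eqP := HQ i; rewrite [p`_i]nth_default ?size_comp_XaddC ?degP //.
by rewrite mulr0 mulf_eq0 (negPf (ffact_neq0 _)) orbF.
Qed.

(** The polynomial w^n S(g / w) in w, with S the polynomial [S_poly R n k]. *)
Definition S_reversed (g : R[i]) : {poly R[i]} :=
  \poly_(i < n.+1) ('C(n + k, n - i + k)%:R * g ^+ (n - i)).

Lemma size_S_reversed g : size (S_reversed g) = n.+1.
Proof.
rewrite size_poly_eq // subnn add0n expr0 mulr1 pnatr_eq0 -lt0n bin_gt0.
exact: leq_addl.
Qed.

Lemma S_reversed_root g m : g != 0 -> root (S_reversed g) m ->
  m != 0 /\ root (S_poly R n k) (g / m).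
Proof.
(* The constant term is [g ^+ n], which is nonzero. *)
move=> g0 /rootP Gm; have m0 : m != 0.
  apply: contra_eqN Gm => /eqP ->.
  by rewrite horner_coef0 coef_poly /= subn0 binn mul1r expf_neq0.
split=> //; apply/rootP; apply: (mulfI (expf_neq0 n m0)).
rewrite mulr0 -[RHS]Gm horner_poly horner_sum big_distrr /=.
rewrite (reindex_inj rev_ord_inj) /=; apply: eq_bigr => i _.
have ni : (i <= n)%N by rewrite -ltnS.
rewrite subSS hornerZ hornerXn mulrCA -mulrA; congr (_ * _).
by rewrite -{1}(subnK ni) exprD expr_div_n mulrC -mulrA mulKf ?expf_neq0.
Qed.

(** The signs of the pairing cancel those of the powers of [- g], and its factorial weights turn the
    binomials of S into the factors of [is_Q_coef]. *)
Lemma apolar_S_reversed Q g : is_Q n k P xi Q ->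
  apolar n (nth 0 p) (nth 0 (S_reversed (- g))) =
  n`!%:R * (Q \Po ('X + xi%:P)).[g].
Proof.
move=> HQ; have [sQ _ _] := HQ; move/is_Q_coef: HQ => HQ.
have nk0 : ((n + k) ^_ k)%:R != 0 :> R[i] by rewrite addnC ffact_neq0.
rewrite horner_coef size_comp_XaddC sQ big_distrr; apply: eq_bigr => j _ /=.
have nj : (j <= n)%N by rewrite -ltnS.
rewrite coef_poly ltnS leq_subr subKn //.
apply: (mulfI nk0).
(* Both sides equal (n + k)!. *)
have /(congr1 (fun m => m%:R : R[i])) : ((k + j) ^_ k * (j`! * (n - j)`! * 'C(n + k, j + k)) = (n + k) ^_ k * n`!)%N.
  have kj : (k <= k + j)%N by rewrite leq_addr.
  have nk : (k <= n + k)%N by rewrite leq_addl.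
  have jk : (j + k <= n + k)%N by rewrite leq_add2r.
  have := bin_fact jk; rewrite subnDr.
  have := ffact_fact kj; have := ffact_fact nk; rewrite addnK addKn (addnC j).
  move=> -> <- <-; ring.
rewrite !natrM => e.
have s2 : (-1) ^+ j * (-1) ^+ j = 1 :> R[i] by rewrite -expr2 sqrr_sign.
rewrite (exprNn g); move: e (HQ j) s2.
move: (_ ^_ _)%:R (_ ^_ _)%:R j`!%:R (n - j)`!%:R 'C(_, _)%:R n`!%:R
  ((-1) ^+ j) => N F a b c f s.
move: p`_j (_ \Po _)`_j (g ^+ j) => x y h e1 e2 s2.
transitivity (N * x * (s * s) * (a * b * c) * h); first by ring.
rewrite s2 -e2 mulr1 -(mulrA y) e1; ring.
Qed.
End Szego.

(** * Existence, uniqueness and zeros of [Q] *)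

Lemma S_poly_has_root (R : realType) n k : (1 <= n)%N ->
  exists b, root (S_poly R n k) b.
Proof.
move=> n1; apply/closed_rootP.
rewrite /S_poly -(poly_def _ (fun j => 'C(n + k, j + k)%:R)).
by rewrite size_poly_eq ?binn ?oner_eq0 // eqSS -lt0n.
Qed.

Theorem proposition3p3 (R : realType) (n k : nat) (P : {poly R[i]}) (xi : R[i])
    (n_ge1 : (1 <= n)%N) (k_ge1 : (1 <= k)%N) (degP : size P = n.+1) :
  (exists! Q : {poly R[i]}, is_Q n k P xi Q) /\
  (forall Q : {poly R[i]}, is_Q n k P xi Q ->
    forall K : set R[i], circular_region K ->
      zeros (P \Po ('X + xi%:P)) `<=` K ->
      forall q : R[i], q \in zeros Q ->
        exists alpha beta : R[i],
          [/\ alpha \in K, beta \in zeros (S_poly R n k) &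
              q = xi - alpha * beta]).
Proof.
split=> [|Q HQ K cK PK q /set_mem Qq]; first exact: is_Q_exists_unique.
have Qg : (Q \Po ('X + xi%:P)).[q - xi] = 0.
  by rewrite horner_comp hornerD hornerX hornerC subrK; apply/rootP.
have [g0|g0] := eqVneq (q - xi) 0.
  (* For [q = xi] take alpha = 0 and any zero of S as beta. Here 0 lies in [K] because P(xi + w)
     vanishes at 0 along with Q(xi + w), by [is_Q_coef] at index 0. *)
  have [b Sb] := S_poly_has_root R k n_ge1.
  exists 0, b; split; [|exact/mem_set|by rewrite mul0r subr0; apply/subr0_eq].
  apply/mem_set/PK/rootP; rewrite horner_coef0.
  have := (is_Q_coef k xi degP Q).1 HQ 0%N.
  move: Qg; rewrite g0 horner_coef0 => ->; rewrite mul0r => /esym/eqP.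
  by rewrite mulf_eq0 pnatr_eq0 -leqn0 leqNgt ffact_gt0 leq_addl => /eqP.
have [m Gm Km] : exists2 m, root (S_reversed n k (- (q - xi))) m & K m.
  apply: (grace_zerosC (circular_region_laguerre_convex cK) _ (size_S_reversed _ _ _) PK).
    by rewrite size_comp_XaddC.
  by rewrite (apolar_S_reversed degP _ HQ) Qg mulr0.
have Ng0 : - (q - xi) != 0 by rewrite oppr_eq0.
have [m0 Sm] := S_reversed_root Ng0 Gm.
exists m, (- (q - xi) / m); split; [exact/mem_set|exact/mem_set|].
by rewrite mulrC divfK // opprK addrC subrK.
Qed.
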